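(* Every surface of revolution in $\mathbb{R}^3$ of constant Gauss curvature $K\neq0$ is homothetic to $$(s,\vartheta)\mapsto x(s,\vartheta)=(r(s)\cos\vartheta,\ r(s)\sin\vartheta,\ h(s)),$$ where the profile curve $s\mapsto(r(s),h(s))$ is one of the following (with $K=\pm1$ denoting the Gauss curvature of the listed surface, and $p\in(0,1)$): (i) $r(s)=p\,\mathrm{cn}_p(s)$, with $h(s)=(E_p\circ\mathrm{am}_p)(s)$ if $K=+1$, and $h(s)=(E_p\circ\mathrm{am}_p)(s)-s$ if $K=-1$; (ii) $r(s)=\dfrac{1}{\cosh(s)}$, with $h(s)=\tanh(s)$ if $K=+1$ (sphere), and $h(s)=\tanh(s)-s$ if $K=-1$ (pseudosphere); (iii) $r(s)=\tfrac1p\,\mathrm{dn}_p(\tfrac sp)$, with $h(s)=\tfrac1p(E_p\circ\mathrm{am}_p)(\tfrac sp)-\tfrac{1-p^2}{p^2}\,s$ if $K=+1$, and $h(s)=\tfrac1p(E_p\circ\mathrm{am}_p)(\tfrac sp)-\tfrac1{p^2}\,s$ if $K=-1$.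
   Context: For a modulus $p\in(0,1)$: - $E_p(\phi)=\int_0^\phi\sqrt{1-p^2\sin^2\varphi}\,d\varphi$ is the incomplete elliptic integral of the second kind; - $\mathrm{am}_p$ is the Jacobi amplitude function, i.e. the inverse of $\phi\mapsto\int_0^\phi\frac{d\varphi}{\sqrt{1-p^2\sin^2\varphi}}$; - $\mathrm{sn}_p=\sin\circ\,\mathrm{am}_p$, $\mathrm{cn}_p=\cos\circ\,\mathrm{am}_p$ and $\mathrm{dn}_p=\sqrt{1-p^2\,\mathrm{sn}_p^2}$ are the Jacobi elliptic functions. A surface of revolution is a smooth, connected, immersed surface obtained by rotating a profile curve about an axis not meeting it. ''Homothetic to'' means: up to a similarity of $\mathbb{R}^3$ (scaling composed with a Euclidean motion or reflection) and up to reparametrization of the profile curve (including shifts of the parameter), the surface is the listed one restricted to a suitable interval of parameters $s$. *)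

(* Defs.v *)
From Stdlib Require Import Reals ClassicalEpsilon.
From Coquelicot Require Import Coquelicot.
Open Scope R_scope.

(** * Elliptic integrals and Jacobi elliptic functions of modulus [p] *)

Definition ellint_E (p phi : R) : R :=
  RInt (fun v => sqrt (1 - p ^ 2 * sin v ^ 2)) 0 phi.

Definition ellint_F (p phi : R) : R :=
  RInt (fun v => / sqrt (1 - p ^ 2 * sin v ^ 2)) 0 phi.

(** For [0 < p < 1] the integrand of [ellint_F p] is at least 1, so
    [ellint_F p] is a bijection of [R] and the value chosen here is the only
    possible one. *)
Definition am (p s : R) : R :=
  epsilon (inhabits 0) (fun phi => ellint_F p phi = s).

Definition sn (p s : R) : R := sin (am p s).
Definition cn (p s : R) : R := cos (am p s).
Definition dn (p s : R) : R := sqrt (1 - p ^ 2 * sn p s ^ 2).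

(** * Euclidean space

    The vector operations [plus], [minus], [scal] are Coquelicot's
    componentwise ones on products. *)

Definition R3 : Type := (R * R * R)%type.

Definition crd1 (u : R3) : R := fst (fst u).
Definition crd2 (u : R3) : R := snd (fst u).
Definition crd3 (u : R3) : R := snd u.

Definition dot (u v : R3) : R :=
  crd1 u * crd1 v + crd2 u * crd2 v + crd3 u * crd3 v.

Definition cross (u v : R3) : R3 :=
  (crd2 u * crd3 v - crd3 u * crd2 v,
   crd3 u * crd1 v - crd1 u * crd3 v,
   crd1 u * crd2 v - crd2 u * crd1 v).

Definition enorm (u : R3) : R := sqrt (dot u u).

Definition orthonormal (e1 e2 e3 : R3) : Prop :=
  dot e1 e1 = 1 /\ dot e2 e2 = 1 /\ dot e3 e3 = 1 /\
  dot e1 e2 = 0 /\ dot e1 e3 = 0 /\ dot e2 e3 = 0.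

Definition isometry (f : R3 -> R3) : Prop :=
  forall u v, enorm (minus (f u) (f v)) = enorm (minus u v).

Definition similarity (f : R3 -> R3) : Prop :=
  exists (c : R) (g : R3 -> R3),
    0 < c /\ isometry g /\ forall u, f u = scal c (g u).

(** * Smooth functions on open intervals, with possibly infinite endpoints *)

Definition in_itv (a b : Rbar) (t : R) : Prop := Rbar_lt a t /\ Rbar_lt t b.

Definition smooth_on (a b : Rbar) (f : R -> R) : Prop :=
  forall (n : nat) (t : R), in_itv a b t -> ex_derive_n f n t.

(** [phi] is a smooth reparametrization of [(a, b)] onto [(c, d)]; either
    orientation is allowed. *)
Definition reparametrization (a b c d : Rbar) (phi : R -> R) : Prop :=
  smooth_on a b phi /\
  (forall t, in_itv a b t -> Derive phi t <> 0) /\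
  (forall t, in_itv a b t -> in_itv c d (phi t)) /\
  (forall s, in_itv c d s -> exists t, in_itv a b t /\ phi t = s).

(** * Parametrized surfaces *)

Definition Derive3 (c : R -> R3) (t : R) : R3 :=
  (Derive (fun u => crd1 (c u)) t,
   Derive (fun u => crd2 (c u)) t,
   Derive (fun u => crd3 (c u)) t).

Definition d1 (X : R -> R -> R3) (s t : R) : R3 := Derive3 (fun u => X u t) s.
Definition d2 (X : R -> R -> R3) (s t : R) : R3 := Derive3 (fun v => X s v) t.

Definition immersed_at (X : R -> R -> R3) (s t : R) : Prop :=
  cross (d1 X s t) (d2 X s t) <> (0, 0, 0).

Definition unit_normal (X : R -> R -> R3) (s t : R) : R3 :=
  let w := cross (d1 X s t) (d2 X s t) in scal (/ enorm w) w.

(** Quotient of the determinants of the second and first fundamental forms;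
    meaningful where [X] is immersed. *)
Definition gauss_curvature (X : R -> R -> R3) (s t : R) : R :=
  let E := dot (d1 X s t) (d1 X s t) in
  let F := dot (d1 X s t) (d2 X s t) in
  let G := dot (d2 X s t) (d2 X s t) in
  let nu := unit_normal X s t in
  let L := dot (d1 (d1 X) s t) nu in
  let M := dot (d2 (d1 X) s t) nu in
  let N := dot (d2 (d2 X) s t) nu in
  (L * N - M ^ 2) / (E * G - F ^ 2).

(** * Surfaces of revolution *)

Definition revolve (r h : R -> R) (s theta : R) : R3 :=
  (r s * cos theta, r s * sin theta, h s).

(** The axis is the line through [o] with direction [e3]; the profile curve
    [t |-> o + r t e1 + h t e3] lies in the plane through the axis spanned by
    [e1] and [e3], and avoids the axis exactly when [r] does not vanish. *)
Definition surface_of_revolution (a b : Rbar) (X : R -> R -> R3) : Prop :=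
  Rbar_lt a b /\
  (exists (o e1 e2 e3 : R3) (r h : R -> R),
    orthonormal e1 e2 e3 /\
    smooth_on a b r /\ smooth_on a b h /\
    (forall t, in_itv a b t -> r t <> 0) /\
    (forall t theta, in_itv a b t ->
       X t theta =
         plus o (plus (scal (r t * cos theta) e1)
                (plus (scal (r t * sin theta) e2)
                      (scal (h t) e3))))) /\
  (forall t theta, in_itv a b t -> immersed_at X t theta).

(** [X] on [(a, b)] is, up to a similarity of space and a reparametrization of
    the profile curve, the restriction of [Y] to some interval [(c, d)]. *)
Definition homothetic_to_part_of
    (a b : Rbar) (X Y : R -> R -> R3) : Prop :=
  exists (c d : Rbar) (phi : R -> R) (f : R3 -> R3),
    reparametrization a b c d phi /\ similarity f /\
    forall t theta, in_itv a b t -> X t theta = f (Y (phi t) theta).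

(** [listed_profile K r h]: the profile curve [(r, h)] is in the list for the
    value [K] of the Gauss curvature. *)
Inductive listed_profile : R -> (R -> R) -> (R -> R) -> Prop :=
| listed_cn_pos (p : R) : 0 < p < 1 ->
    listed_profile 1
      (fun s => p * cn p s)
      (fun s => ellint_E p (am p s))
| listed_cn_neg (p : R) : 0 < p < 1 ->
    listed_profile (-1)
      (fun s => p * cn p s)
      (fun s => ellint_E p (am p s) - s)
| listed_sphere :
    listed_profile 1
      (fun s => 1 / cosh s)
      (fun s => tanh s)
| listed_pseudosphere :
    listed_profile (-1)
      (fun s => 1 / cosh s)
      (fun s => tanh s - s)
| listed_dn_pos (p : R) : 0 < p < 1 ->
    listed_profile 1
      (fun s => 1 / p * dn p (s / p))
      (fun s => 1 / p * ellint_E p (am p (s / p)) - (1 - p ^ 2) / p ^ 2 * s)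
| listed_dn_neg (p : R) : 0 < p < 1 ->
    listed_profile (-1)
      (fun s => 1 / p * dn p (s / p))
      (fun s => 1 / p * ellint_E p (am p (s / p)) - 1 / p ^ 2 * s).

(* Main.v *)
Require Import Defs.
From Stdlib Require Import Reals Lra ClassicalEpsilon Ranalysis5.
From Coquelicot Require Import Coquelicot.
(* again, because [d1] is also a projection in the real analysis library *)
Import Defs.
Open Scope R_scope.

(** For a profile curve [(r, h)] in an arbitrary parameter the Gauss curvature is
    [K = h' * (r' * h'' - r'' * h') / (r * V ^ 2)] with [V = r' ^ 2 + h' ^ 2]
    ([revolution_geometry]). If [K <> 0], then [h'] has no zero, so [h'] and [r]
    have constant signs [delta] and [tau]. Write [K = K0 * lambda ^ 2] with
    [K0 = 1] or [K0 = -1], put [rho = tau * lambda * r], and pass to the parameter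
    [s] with [ds = lambda * delta * V / h' dt]. In this parameter the curvature
    equation becomes, with [zeta = d rho / ds],

      [d zeta / ds = (2 * C - 1) * rho - 2 * rho ^ 3],
      [zeta ^ 2 = (C - rho ^ 2) * (1 - C + rho ^ 2)],

    with a constant [C > 0], and the height [K0 * delta * lambda * h] has the
    derivative [rho ^ 2 + 1 - C] if [K0 = 1] and [rho ^ 2 - C] if [K0 = -1]
    ([phase_system_of_curvature]). The radius equation is the same for both signs
    of the curvature.

    The listed profiles solve exactly this system: the family of [cn] for [C < 1],
    the sphere and the pseudosphere for [C = 1], the family of [dn] for [C > 1]
    ([listed_profile_exists]). Each of them is defined for all [s] and passes
    through every point [(y, z)] with [0 < y] of the level curve of the first
    integral. So there is a shift of the parameter after which the listed profile
    and the given one have the same initial values; by uniqueness for the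
    differential equation they agree ([phase_system_follows_model]). What is left
    between the two surfaces is the factor [1 / lambda], the Euclidean motion or
    reflection given by the frame, a half turn about the axis if [tau = -1], and a
    reversal of the axis if [K0 * delta = -1].

    That the listed surfaces have curvature [K0] follows from the same system
    ([model_curvature]). *)

(** * Calculus and smoothness on open intervals *)

(** After [auto_derive], unknown functions occur through [ex_derive] and
    [Derive]; the hypotheses of the form [is_derive f x l] settle both. *)
Ltac ex_derive_assumption := repeat split; try exact I; eexists; eassumption.
Ltac Derive_assumption :=
  repeat match goal with
  | |- context [Derive ?f ?x] => erewrite (is_derive_unique f x) by eassumption
  end.

Lemma in_itv_between (a b : Rbar) (x y z : R) :
  in_itv a b x -> in_itv a b z -> x <= y <= z -> in_itv a b y.
Proof.
  unfold in_itv; destruct a, b; simpl; intuition lra.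
Qed.

Lemma in_itv_Rmin_Rmax (a b : Rbar) (x y z : R) :
  in_itv a b x -> in_itv a b z -> Rmin x z <= y <= Rmax x z -> in_itv a b y.
Proof.
  intros Hx Hz Hy.
  destruct (Rle_dec x z).
  - rewrite Rmin_left, Rmax_right in Hy by lra. now apply (in_itv_between a b x y z).
  - rewrite Rmin_right, Rmax_left in Hy by lra. now apply (in_itv_between a b z y x).
Qed.

Lemma in_itv_locally (a b : Rbar) (t : R) :
  in_itv a b t -> locally t (in_itv a b).
Proof.
  intros [Ha Hb].
  apply filter_and.
  - exact (open_Rbar_gt' (Finite t) a Ha).
  - exact (open_Rbar_lt' (Finite t) b Hb).
Qed.

Lemma in_itv_inhabited (a b : Rbar) : Rbar_lt a b -> exists t, in_itv a b t.
Proof.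
  unfold in_itv; destruct a as [x| |], b as [y| |]; simpl; try tauto; intros H.
  - exists ((x + y) / 2); lra.
  - exists (x + 1); lra.
  - exists (y - 1); lra.
  - exists 0; tauto.
Qed.

Lemma in_itv_enlarge (a b : Rbar) (t : R) :
  in_itv a b t ->
  exists t1 t2, in_itv a b t1 /\ in_itv a b t2 /\ t1 < t < t2.
Proof.
  intros Ht.
  destruct (in_itv_locally a b t Ht) as [e He].
  pose proof (cond_pos e) as He0.
  exists (t - e / 2), (t + e / 2); repeat split; try lra;
    apply He; unfold ball; simpl; unfold AbsRing_ball, abs, minus, plus, opp; simpl;
    unfold Rabs; destruct Rcase_abs; lra.
Qed.

Lemma MVT_itv (a b : Rbar) (f df : R -> R) :
  (forall t, in_itv a b t -> is_derive f t (df t)) ->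
  forall x y, in_itv a b x -> in_itv a b y ->
  exists c, in_itv a b c /\ f y - f x = df c * (y - x).
Proof.
  intros Hf x y Hx Hy.
  destruct (MVT_gen f x y df) as (c & Hc & Heq).
  - intros z Hz; apply Hf, (in_itv_Rmin_Rmax a b x z y Hx Hy); lra.
  - intros z Hz; apply derivable_continuous_pt.
    exists (df z); apply is_derive_Reals, Hf, (in_itv_Rmin_Rmax a b x z y Hx Hy); lra.
  - exists c; split; [apply (in_itv_Rmin_Rmax a b x c y Hx Hy); lra | exact Heq].
Qed.

Lemma constant_of_derive_zero (a b : Rbar) (f : R -> R) :
  (forall t, in_itv a b t -> is_derive f t 0) ->
  forall x y, in_itv a b x -> in_itv a b y -> f y = f x.
Proof.
  intros Hf x y Hx Hy.
  destruct (MVT_itv a b f (fun _ => 0) Hf x y Hx Hy) as (c & _ & Heq). lra.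
Qed.

(** The two points may come in either order, so that surjectivity statements
    need no case distinction on monotonicity. *)
Lemma IVT_itv (a b : Rbar) (f : R -> R) :
  (forall t, in_itv a b t -> continuous f t) ->
  forall x y v, in_itv a b x -> in_itv a b y -> f x < v < f y ->
  exists z, in_itv a b z /\ f z = v.
Proof.
  intros Hf x y v Hx Hy Hv.
  destruct (Rtotal_order x y) as [Hxy|[Hxy|Hxy]].
  - destruct (IVT_interv (fun t => f t - v) x y) as (z & Hz & Heq); try lra.
    + intros c Hc. apply continuity_pt_filterlim.
      apply (continuous_minus f (fun _ => v)); [|apply continuous_const].
      apply Hf, (in_itv_between a b x c y); auto.
    + exists z; split; [apply (in_itv_between a b x z y); auto | lra].
  - subst; lra.
  - destruct (IVT_interv (fun t => v - f t) y x) as (z & Hz & Heq); try lra.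
    + intros c Hc. apply continuity_pt_filterlim.
      apply (continuous_minus (fun _ => v) f); [apply continuous_const|].
      apply Hf, (in_itv_between a b y c x); auto.
    + exists z; split; [apply (in_itv_between a b y z x); auto | lra].
Qed.

Lemma constant_sign (a b : Rbar) (f : R -> R) :
  Rbar_lt a b ->
  (forall t, in_itv a b t -> continuous f t) ->
  (forall t, in_itv a b t -> f t <> 0) ->
  exists s, s ^ 2 = 1 /\ forall t, in_itv a b t -> 0 < s * f t.
Proof.
  intros Hab Hc Hn.
  destruct (in_itv_inhabited a b Hab) as [t0 Ht0].
  assert (Hsame : forall t1 t2, in_itv a b t1 -> in_itv a b t2 ->
            f t1 < 0 -> 0 < f t2 -> False).
  { intros t1 t2 H1 H2 Hneg Hpos.
    destruct (IVT_itv a b f Hc t1 t2 0 H1 H2) as (z & Hz & Heq); [lra|].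
    exact (Hn z Hz Heq). }
  destruct (Rtotal_order (f t0) 0) as [H|[H|H]].
  - exists (-1); split; [ring|]; intros t Ht.
    destruct (Rtotal_order (f t) 0) as [H'|[H'|H']]; [lra| |].
    + now apply Hn in H'.
    + now destruct (Hsame t0 t).
  - now apply Hn in H.
  - exists 1; split; [ring|]; intros t Ht.
    destruct (Rtotal_order (f t) 0) as [H'|[H'|H']]; [| |lra].
    + now destruct (Hsame t t0).
    + now apply Hn in H'.
Qed.

(** [n]-fold differentiability, peeling the derivatives off from the inside. In
    [ex_derive_n] they are peeled off from the outside, which does not fit the
    inductive proof of the product rule: there [Derive (f * g)] has to be
    rewritten as a sum of products before it is differentiated further. *)
Fixpoint differentiable_on (a b : Rbar) (n : nat) (f : R -> R) : Prop :=
  match n with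
  | O => True
  | S m => (forall t, in_itv a b t -> ex_derive f t) /\
           differentiable_on a b m (Derive f)
  end.

Lemma smooth_on_differentiable_on (a b : Rbar) (f : R -> R) :
  smooth_on a b f <-> forall n, differentiable_on a b n f.
Proof.
  split.
  - intros Hf n; revert f Hf; induction n as [|n IH]; intros f Hf; [exact I|].
    split; [intros t Ht; exact (Hf 1%nat t Ht)|].
    apply IH. intros m t Ht.
    destruct m as [|m]; [exact I|].
    apply (ex_derive_ext (Derive_n f (S m))).
    { intros u. rewrite <- PeanoNat.Nat.add_1_r, <- Derive_n_comp. reflexivity. }
    exact (Hf (S (S m)) t Ht).
  - intros Hf n t Ht; specialize (Hf n); revert f Hf; induction n as [|n IH]; intros f Hf.
    + exact I.
    + destruct Hf as [H1 H2]; specialize (IH _ H2).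
      destruct n as [|n]; [exact (H1 t Ht)|].
      apply (ex_derive_ext (Derive_n (Derive f) n)); [|exact IH].
      intros u. rewrite <- (PeanoNat.Nat.add_1_r n), <- Derive_n_comp. reflexivity.
Qed.

Lemma differentiable_on_ext (a b : Rbar) (n : nat) (f g : R -> R) :
  (forall t, in_itv a b t -> f t = g t) ->
  differentiable_on a b n f -> differentiable_on a b n g.
Proof.
  revert f g; induction n as [|n IH]; intros f g Heq Hf; [exact I|].
  destruct Hf as [H1 H2].
  assert (Hloc : forall t, in_itv a b t -> locally t (fun u => f u = g u)).
  { intros t Ht; apply filter_imp with (2 := in_itv_locally a b t Ht); exact Heq. }
  split.
  - intros t Ht; apply (ex_derive_ext_loc f); auto.
  - apply (IH (Derive f)); [|exact H2].
    intros t Ht; apply Derive_ext_loc; auto.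
Qed.

Lemma differentiable_on_pred (a b : Rbar) (n : nat) (f : R -> R) :
  differentiable_on a b (S n) f -> differentiable_on a b n f.
Proof.
  revert f; induction n as [|n IH]; intros f; [easy|].
  intros [H1 H2]; split; [exact H1 | apply IH; exact H2].
Qed.

Lemma differentiable_on_const (a b : Rbar) (n : nat) (c : R) :
  differentiable_on a b n (fun _ => c).
Proof.
  revert c; induction n as [|n IH]; intros c; [exact I|].
  split; [intros t _; apply ex_derive_const|].
  apply (differentiable_on_ext a b n (fun _ => 0)); [|apply IH].
  intros t _; symmetry; apply Derive_const.
Qed.

Lemma differentiable_on_plus (a b : Rbar) (n : nat) (f g : R -> R) :
  differentiable_on a b n f -> differentiable_on a b n g ->
  differentiable_on a b n (fun t => f t + g t).
Proof.
  revert f g; induction n as [|n IH]; intros f g; [easy|].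
  intros [Hf1 Hf2] [Hg1 Hg2]; split.
  - intros t Ht; apply (ex_derive_plus f g); auto.
  - apply (differentiable_on_ext a b n (fun t => Derive f t + Derive g t)).
    + intros t Ht; symmetry; apply Derive_plus; auto.
    + apply IH; auto.
Qed.

Lemma differentiable_on_mult (a b : Rbar) (n : nat) (f g : R -> R) :
  differentiable_on a b n f -> differentiable_on a b n g ->
  differentiable_on a b n (fun t => f t * g t).
Proof.
  revert f g; induction n as [|n IH]; intros f g; [easy|].
  intros Hf Hg.
  pose proof (differentiable_on_pred _ _ _ _ Hf) as Hf0.
  pose proof (differentiable_on_pred _ _ _ _ Hg) as Hg0.
  destruct Hf as [Hf1 Hf2], Hg as [Hg1 Hg2]; split.
  - intros t Ht; apply (ex_derive_mult f g); auto.
  - apply (differentiable_on_ext a b n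
             (fun t => Derive f t * g t + f t * Derive g t)).
    + intros t Ht; symmetry; apply Derive_mult; auto.
    + apply differentiable_on_plus; auto.
Qed.

Lemma differentiable_on_inv (a b : Rbar) (n : nat) (f : R -> R) :
  (forall t, in_itv a b t -> f t <> 0) ->
  differentiable_on a b n f -> differentiable_on a b n (fun t => / f t).
Proof.
  intros Hn; induction n as [|n IH]; [easy|].
  intros Hf; specialize (IH (differentiable_on_pred _ _ _ _ Hf)).
  destruct Hf as [Hf1 Hf2]; split.
  - intros t Ht; apply ex_derive_inv; auto.
  - apply (differentiable_on_ext a b n
             (fun t => (-1 * Derive f t) * (/ f t * / f t))).
    + intros t Ht; rewrite Derive_inv by auto.
      pose proof (Hn t Ht); field; auto.
    + repeat apply differentiable_on_mult; auto using differentiable_on_const.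
Qed.

Lemma smooth_on_Derive (a b : Rbar) (f : R -> R) :
  smooth_on a b f -> smooth_on a b (Derive f).
Proof.
  rewrite !smooth_on_differentiable_on; intros Hf n; exact (proj2 (Hf (S n))).
Qed.

(** A primitive of a smooth function is smooth; this makes the change of
    parameter smooth, which is only known as a primitive. *)
Lemma smooth_on_of_derive (a b : Rbar) (f df : R -> R) :
  (forall t, in_itv a b t -> is_derive f t (df t)) ->
  smooth_on a b df -> smooth_on a b f.
Proof.
  rewrite !smooth_on_differentiable_on; intros Hf Hdf [|n]; [exact I|].
  split; [intros t Ht; exists (df t); auto|].
  apply (differentiable_on_ext a b n df); [|apply Hdf].
  intros t Ht; symmetry; apply is_derive_unique; auto.
Qed.

Lemma smooth_on_is_derive (a b : Rbar) (f : R -> R) (t : R) :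
  smooth_on a b f -> in_itv a b t -> is_derive f t (Derive f t).
Proof.
  intros Hf Ht; apply Derive_correct; exact (Hf 1%nat t Ht).
Qed.

(** Outside the interval [f] is arbitrary, so the integral can be controlled only
    between two points of the interval; that suffices for the derivative. *)
Lemma primitive_itv (a b : Rbar) (f : R -> R) (t0 s0 : R) :
  in_itv a b t0 ->
  (forall t, in_itv a b t -> continuous f t) ->
  exists F, F t0 = s0 /\ forall t, in_itv a b t -> is_derive F t (f t).
Proof.
  intros Ht0 Hf.
  exists (fun t => s0 + RInt f t0 t); split.
  - rewrite RInt_point; unfold zero; simpl; ring.
  - intros t Ht.
    replace (f t) with (plus 0 (f t)) by (unfold plus; simpl; ring).
    apply (is_derive_plus (fun _ => s0) (RInt f t0) t 0 (f t));
      [exact (is_derive_const s0 t)|].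
    apply (is_derive_RInt f (RInt f t0) t0); [|auto].
    apply filter_imp with (2 := in_itv_locally a b t Ht).
    intros u Hu.
    apply (@RInt_correct R_CompleteNormedModule), (@ex_RInt_continuous R_CompleteNormedModule).
    intros z Hz; apply Hf, (in_itv_Rmin_Rmax a b t0 z u); auto.
Qed.

Lemma increasing_itv (a b : Rbar) (phi dphi : R -> R) :
  (forall t, in_itv a b t -> is_derive phi t (dphi t)) ->
  (forall t, in_itv a b t -> 0 < dphi t) ->
  forall x y, in_itv a b x -> in_itv a b y -> x < y -> phi x < phi y.
Proof.
  intros Hd Hp x y Hx Hy Hxy.
  destruct (MVT_itv a b phi dphi Hd x y Hx Hy) as (c & Hc & Heq).
  specialize (Hp c Hc); nra.
Qed.

(** The image of the interval is again an open interval: by monotonicity its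
    infimum and supremum are not attained, and by the intermediate value theorem
    it has no gap. *)
Lemma reparametrization_onto_image (a b : Rbar) (phi dphi : R -> R) :
  (forall t, in_itv a b t -> is_derive phi t (dphi t)) ->
  (forall t, in_itv a b t -> 0 < dphi t) ->
  smooth_on a b dphi ->
  exists c d, reparametrization a b c d phi.
Proof.
  intros Hd Hp Hs.
  pose proof (increasing_itv a b phi dphi Hd Hp) as Hincr.
  set (image := fun s => exists t, in_itv a b t /\ phi t = s).
  destruct (Glb_Rbar_correct image) as [Hc1 Hc2].
  destruct (Lub_Rbar_correct image) as [Hd1 Hd2].
  exists (Glb_Rbar image), (Lub_Rbar image).
  split; [|split; [|split]].
  - exact (smooth_on_of_derive a b phi dphi Hd Hs).
  - intros t Ht; rewrite (is_derive_unique _ _ _ (Hd t Ht)).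
    specialize (Hp t Ht); lra.
  - intros t Ht.
    destruct (in_itv_enlarge a b t Ht) as (t1 & t2 & H1 & H2 & H12).
    split.
    + apply Rbar_le_lt_trans with (phi t1).
      * apply Hc1; exists t1; auto.
      * apply Hincr; tauto.
    + apply Rbar_lt_le_trans with (phi t2).
      * apply Hincr; tauto.
      * apply Hd1; exists t2; auto.
  - intros s [Hs1 Hs2].
    assert (exists t1, in_itv a b t1 /\ phi t1 < s) as (t1 & H1 & H1s).
    { destruct (classic (exists t1, in_itv a b t1 /\ phi t1 < s)) as [H|H]; [exact H|].
      exfalso; apply (Rbar_lt_not_le _ _ Hs1), Hc2.
      intros x (t & Ht & <-); simpl.
      apply Rnot_lt_le; intros Hlt; apply H; exists t; auto. }
    assert (exists t2, in_itv a b t2 /\ s < phi t2) as (t2 & H2 & H2s).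
    { destruct (classic (exists t2, in_itv a b t2 /\ s < phi t2)) as [H|H]; [exact H|].
      exfalso; apply (Rbar_lt_not_le _ _ Hs2), Hd2.
      intros x (t & Ht & <-); simpl.
      apply Rnot_lt_le; intros Hlt; apply H; exists t; auto. }
    apply (IVT_itv a b phi) with t1 t2; auto.
    intros t Ht; apply (ex_derive_continuous phi); exists (dphi t); auto.
Qed.

(** Uniqueness for a linear system in the parameter [s], written in an arbitrary
    parameter [t] with [ds = p dt]. The energy [u ^ 2 + w ^ 2] satisfies
    [|d(energy)/ds| <= (1 + M) energy], so it is decreasing after multiplication
    by [exp (- (1 + M) s)] and increasing after multiplication by
    [exp ((1 + M) s)]. The first fact makes it vanish to the right of [t0], the
    second to the left. *)
Lemma linear_system_zero (a b : Rbar) (u w s p q : R -> R) (M t0 : R) :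
  in_itv a b t0 -> u t0 = 0 -> w t0 = 0 ->
  (forall t, in_itv a b t -> is_derive s t (p t)) ->
  (forall t, in_itv a b t -> 0 < p t) ->
  (forall t, in_itv a b t -> is_derive u t (p t * w t)) ->
  (forall t, in_itv a b t -> is_derive w t (p t * (q t * u t))) ->
  (forall t, in_itv a b t -> Rabs (q t) <= M) ->
  forall t, in_itv a b t -> u t = 0 /\ w t = 0.
Proof.
  intros Ht0 Hu0 Hw0 Hs Hp Hu Hw Hq.
  set (g := fun c t => (u t ^ 2 + w t ^ 2) * exp (c * (1 + M) * s t)).
  set (dg := fun c t => p t * exp (c * (1 + M) * s t) *
     (2 * (1 + q t) * (u t * w t) + c * (1 + M) * (u t ^ 2 + w t ^ 2))).
  assert (Hg : forall c t, in_itv a b t -> is_derive (g c) t (dg c t)).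
  { intros c t Ht; unfold g, dg.
    pose proof (Hs t Ht) as Hst; pose proof (Hu t Ht) as Hut; pose proof (Hw t Ht) as Hwt.
    auto_derive; [ex_derive_assumption | Derive_assumption; ring]. }
  assert (Hbound : forall t, in_itv a b t ->
    Rabs (2 * (1 + q t) * (u t * w t)) <= (1 + M) * (u t ^ 2 + w t ^ 2)).
  { intros t Ht; specialize (Hq t Ht).
    rewrite !Rabs_mult, (Rabs_pos_eq 2) by lra.
    pose proof (Rabs_triang 1 (q t)) as Htr; rewrite Rabs_R1 in Htr.
    rewrite <- (pow2_abs (u t)), <- (pow2_abs (w t)).
    pose proof (Rabs_pos (u t)); pose proof (Rabs_pos (w t)); pose proof (Rabs_pos (q t)).
    pose proof (Rabs_pos (1 + q t)).
    assert (Hamgm : 2 * (Rabs (u t) * Rabs (w t)) <= Rabs (u t) ^ 2 + Rabs (w t) ^ 2)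
      by (pose proof (pow2_ge_0 (Rabs (u t) - Rabs (w t))); nra).
    assert (0 <= Rabs (u t) * Rabs (w t)) by (apply Rmult_le_pos; lra).
    apply Rle_trans with ((1 + M) * (2 * (Rabs (u t) * Rabs (w t)))); nra. }
  assert (Hg0 : forall c, g c t0 = 0) by (intros c; unfold g; rewrite Hu0, Hw0; ring).
  intros t Ht.
  assert (Hle : exists c, g c t <= 0).
  { destruct (Rle_dec t0 t) as [Hle|Hle].
    - exists (-1).
      destruct (MVT_itv a b _ _ (Hg (-1)) t0 t Ht0 Ht) as (x & Hx & Heq).
      rewrite Hg0 in Heq.
      assert (dg (-1) x <= 0); [|nra].
      unfold dg.
      pose proof (Rmult_lt_0_compat _ _ (Hp x Hx) (exp_pos (-1 * (1 + M) * s x))).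
      pose proof (Rle_abs (2 * (1 + q x) * (u x * w x))).
      specialize (Hbound x Hx); nra.
    - exists 1.
      destruct (MVT_itv a b _ _ (Hg 1) t0 t Ht0 Ht) as (x & Hx & Heq).
      rewrite Hg0 in Heq.
      assert (0 <= dg 1 x); [|nra].
      unfold dg.
      pose proof (Rmult_lt_0_compat _ _ (Hp x Hx) (exp_pos (1 * (1 + M) * s x))).
      pose proof (Rle_abs (- (2 * (1 + q x) * (u x * w x)))) as Habs.
      rewrite Rabs_Ropp in Habs.
      specialize (Hbound x Hx).
      apply Rmult_le_pos; lra. }
  destruct Hle as [c Hle]; unfold g in Hle.
  pose proof (exp_pos (c * (1 + M) * s t)).
  pose proof (pow2_ge_0 (u t)); pose proof (pow2_ge_0 (w t)).
  assert (u t ^ 2 + w t ^ 2 <= 0) by nra.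
  split; nra.
Qed.

(** * Curvature of a surface of revolution in an orthonormal frame *)

Definition lincomb (e1 e2 e3 : R3) (x y z : R) : R3 :=
  (x * crd1 e1 + y * crd1 e2 + z * crd1 e3,
   x * crd2 e1 + y * crd2 e2 + z * crd2 e3,
   x * crd3 e1 + y * crd3 e2 + z * crd3 e3).

Definition triple (u v w : R3) : R := dot u (cross v w).

Ltac coords := unfold triple, dot, cross, lincomb, crd1, crd2, crd3 in *; simpl in *.

Lemma dot_lincomb (e1 e2 e3 : R3) (x y z x' y' z' : R) :
  orthonormal e1 e2 e3 ->
  dot (lincomb e1 e2 e3 x y z) (lincomb e1 e2 e3 x' y' z') =
  x * x' + y * y' + z * z'.
Proof.
  intros (H11 & H22 & H33 & H12 & H13 & H23).
  transitivity (x * x' * dot e1 e1 + y * y' * dot e2 e2 + z * z' * dot e3 e3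
    + (x * y' + y * x') * dot e1 e2 + (x * z' + z * x') * dot e1 e3
    + (y * z' + z * y') * dot e2 e3).
  - coords; ring.
  - rewrite H11, H22, H33, H12, H13, H23; ring.
Qed.

Lemma triple_lincomb (e1 e2 e3 : R3) (x y z x' y' z' x'' y'' z'' : R) :
  triple (lincomb e1 e2 e3 x y z) (lincomb e1 e2 e3 x' y' z')
         (lincomb e1 e2 e3 x'' y'' z'') =
  triple e1 e2 e3 *
  (x * (y' * z'' - z' * y'') + y * (z' * x'' - x' * z'') + z * (x' * y'' - y' * x'')).
Proof. coords; ring. Qed.

(** The squared determinant is the Gram determinant. The orientation of the frame
    is left open, and only this square enters the curvature. *)
Lemma triple_orthonormal (e1 e2 e3 : R3) :
  orthonormal e1 e2 e3 -> triple e1 e2 e3 ^ 2 = 1.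
Proof.
  intros (H11 & H22 & H33 & H12 & H13 & H23).
  transitivity (dot e1 e1 * (dot e2 e2 * dot e3 e3 - dot e2 e3 ^ 2)
    - dot e1 e2 * (dot e1 e2 * dot e3 e3 - dot e1 e3 * dot e2 e3)
    + dot e1 e3 * (dot e1 e2 * dot e2 e3 - dot e1 e3 * dot e2 e2)).
  - coords; ring.
  - rewrite H11, H22, H33, H12, H13, H23; ring.
Qed.

(** Turning the frame about the axis by [theta] brings the meridian through the
    parameter [theta] into the coordinate plane of [e1] and [e3]: in the turned
    frame the first and second partial derivatives of a surface of revolution no
    longer contain [theta]. *)
Lemma orthonormal_rotate (e1 e2 e3 : R3) (theta : R) :
  orthonormal e1 e2 e3 ->
  orthonormal (lincomb e1 e2 e3 (cos theta) (sin theta) 0)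
              (lincomb e1 e2 e3 (- sin theta) (cos theta) 0)
              (lincomb e1 e2 e3 0 0 1).
Proof.
  intros H; pose proof (sin2_cos2 theta) as Hsc; unfold Rsqr in Hsc.
  repeat split; rewrite dot_lincomb by exact H; lra.
Qed.

(** Lagrange's identity. *)
Lemma dot_cross_self (u v : R3) :
  dot (cross u v) (cross u v) = dot u u * dot v v - dot u v ^ 2.
Proof. coords; ring. Qed.

Lemma scal_coords (c : R) (u : R3) :
  scal c u = (c * crd1 u, c * crd2 u, c * crd3 u).
Proof. reflexivity. Qed.

Lemma plus_coords (u v : R3) :
  plus u v = (crd1 u + crd1 v, crd2 u + crd2 v, crd3 u + crd3 v).
Proof. reflexivity. Qed.

Lemma minus_coords (u v : R3) :
  minus u v = (crd1 u - crd1 v, crd2 u - crd2 v, crd3 u - crd3 v).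
Proof. reflexivity. Qed.

Lemma dot_scal_r (u v : R3) (c : R) : dot u (scal c v) = c * dot u v.
Proof. rewrite scal_coords; coords; ring. Qed.

(** The normalization of the normal vector can be cleared: by Lagrange's identity
    the squared length of the cross product is the determinant [W] of the first
    fundamental form, and each entry of the second fundamental form is a triple
    product divided by [sqrt W]. *)
Lemma gauss_curvature_triple (X : R -> R -> R3) (s t : R) :
  let W := dot (d1 X s t) (d1 X s t) * dot (d2 X s t) (d2 X s t)
           - dot (d1 X s t) (d2 X s t) ^ 2 in
  0 < W ->
  gauss_curvature X s t =
  (triple (d1 (d1 X) s t) (d1 X s t) (d2 X s t)
     * triple (d2 (d2 X) s t) (d1 X s t) (d2 X s t)
   - triple (d2 (d1 X) s t) (d1 X s t) (d2 X s t) ^ 2) / W ^ 2.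
Proof.
  intros W HW; unfold gauss_curvature, unit_normal; cbv zeta; fold W.
  rewrite !dot_scal_r; unfold enorm; rewrite dot_cross_self; fold W.
  replace (_ * _ - _) with
   ((triple (d1 (d1 X) s t) (d1 X s t) (d2 X s t)
     * triple (d2 (d2 X) s t) (d1 X s t) (d2 X s t)
   - triple (d2 (d1 X) s t) (d1 X s t) (d2 X s t) ^ 2) * (/ sqrt W * / sqrt W))
   by (unfold triple; ring).
  rewrite <- Rinv_mult, sqrt_sqrt by lra.
  clearbody W; field; lra.
Qed.

Lemma plus_scal_lincomb (o e1 e2 e3 : R3) (x y z : R) :
  plus o (plus (scal x e1) (plus (scal y e2) (scal z e3))) =
  (crd1 o + crd1 (lincomb e1 e2 e3 x y z),
   crd2 o + crd2 (lincomb e1 e2 e3 x y z),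
   crd3 o + crd3 (lincomb e1 e2 e3 x y z)).
Proof.
  rewrite !scal_coords, !plus_coords; coords; apply f_equal2; [apply f_equal2|]; ring.
Qed.

Lemma Derive3_ext_loc (c c' : R -> R3) (t : R) :
  locally t (fun u => c u = c' u) -> Derive3 c t = Derive3 c' t.
Proof.
  intros H; unfold Derive3.
  apply f_equal2; [apply f_equal2|]; apply Derive_ext_loc;
    apply filter_imp with (2 := H); intros u ->; reflexivity.
Qed.

Lemma Derive3_lincomb (o e1 e2 e3 : R3) (x y z : R -> R) (x' y' z' t : R) :
  is_derive x t x' -> is_derive y t y' -> is_derive z t z' ->
  Derive3 (fun u => (crd1 o + crd1 (lincomb e1 e2 e3 (x u) (y u) (z u)),
                     crd2 o + crd2 (lincomb e1 e2 e3 (x u) (y u) (z u)),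
                     crd3 o + crd3 (lincomb e1 e2 e3 (x u) (y u) (z u)))) t =
  lincomb e1 e2 e3 x' y' z'.
Proof.
  intros Hx Hy Hz; unfold Derive3, lincomb, crd1, crd2, crd3; simpl.
  apply f_equal2; [apply f_equal2|]; apply is_derive_unique; auto_derive;
    first [ex_derive_assumption | Derive_assumption; ring].
Qed.

Lemma lincomb_origin (e1 e2 e3 : R3) (x y z : R) :
  lincomb e1 e2 e3 x y z =
  (crd1 (0, 0, 0) + crd1 (lincomb e1 e2 e3 x y z),
   crd2 (0, 0, 0) + crd2 (lincomb e1 e2 e3 x y z),
   crd3 (0, 0, 0) + crd3 (lincomb e1 e2 e3 x y z)).
Proof. coords; apply f_equal2; [apply f_equal2|]; ring. Qed.

Lemma Derive3_lincomb0 (e1 e2 e3 : R3) (x y z : R -> R) (x' y' z' t : R) :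
  is_derive x t x' -> is_derive y t y' -> is_derive z t z' ->
  Derive3 (fun u => lincomb e1 e2 e3 (x u) (y u) (z u)) t =
  lincomb e1 e2 e3 x' y' z'.
Proof.
  intros Hx Hy Hz; rewrite <- (Derive3_lincomb (0, 0, 0) e1 e2 e3 x y z x' y' z' t Hx Hy Hz).
  apply Derive3_ext_loc, filter_forall; intros u; apply lincomb_origin.
Qed.

Lemma lincomb_rotate (e1 e2 e3 : R3) (theta x y z : R) :
  lincomb e1 e2 e3 (x * cos theta - y * sin theta) (x * sin theta + y * cos theta) z =
  lincomb (lincomb e1 e2 e3 (cos theta) (sin theta) 0)
          (lincomb e1 e2 e3 (- sin theta) (cos theta) 0)
          (lincomb e1 e2 e3 0 0 1) x y z.
Proof. coords; apply f_equal2; [apply f_equal2|]; ring. Qed.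

(** The curvature depends only on the profile curve, and being immersed excludes
    the points on the axis and the stationary points of the profile curve. *)
Lemma revolution_geometry (a b : Rbar) (X : R -> R -> R3) (o e1 e2 e3 : R3)
    (r h r1 h1 r2 h2 : R -> R) (t theta : R) :
  orthonormal e1 e2 e3 ->
  (forall t, in_itv a b t -> is_derive r t (r1 t)) ->
  (forall t, in_itv a b t -> is_derive h t (h1 t)) ->
  (forall t, in_itv a b t -> is_derive r1 t (r2 t)) ->
  (forall t, in_itv a b t -> is_derive h1 t (h2 t)) ->
  (forall t theta, in_itv a b t ->
     X t theta = plus o (plus (scal (r t * cos theta) e1)
                (plus (scal (r t * sin theta) e2) (scal (h t) e3)))) ->
  in_itv a b t ->
  immersed_at X t theta ->
  r t <> 0 /\ 0 < r1 t ^ 2 + h1 t ^ 2 /\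
  gauss_curvature X t theta =
    h1 t * (r1 t * h2 t - r2 t * h1 t) / (r t * (r1 t ^ 2 + h1 t ^ 2) ^ 2).
Proof.
  intros Ho Hr Hh Hr1 Hh1 HX Ht.
  assert (Hloc : forall t, in_itv a b t -> locally t (in_itv a b))
    by apply in_itv_locally.
  assert (HX' : forall t th, in_itv a b t -> X t th =
     (crd1 o + crd1 (lincomb e1 e2 e3 (r t * cos th) (r t * sin th) (h t)),
      crd2 o + crd2 (lincomb e1 e2 e3 (r t * cos th) (r t * sin th) (h t)),
      crd3 o + crd3 (lincomb e1 e2 e3 (r t * cos th) (r t * sin th) (h t)))).
  { intros u th Hu; rewrite (HX u th Hu); apply plus_scal_lincomb. }
  assert (D1 : forall t th, in_itv a b t -> d1 X t th =
     lincomb e1 e2 e3 (r1 t * cos th) (r1 t * sin th) (h1 t)).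
  { intros u th Hu; unfold d1.
    etransitivity.
    { apply Derive3_ext_loc, filter_imp with (2 := Hloc u Hu).
      intros v Hv; apply HX'; exact Hv. }
    apply (Derive3_lincomb o e1 e2 e3 (fun u => r u * cos th) (fun u => r u * sin th) h);
      [| |auto];
      (specialize (Hr u Hu); auto_derive; [ex_derive_assumption | Derive_assumption; ring]). }
  assert (D2 : forall t th, in_itv a b t -> d2 X t th =
     lincomb e1 e2 e3 (- r t * sin th) (r t * cos th) 0).
  { intros u th Hu; unfold d2.
    etransitivity.
    { apply Derive3_ext_loc, filter_forall; intros v; apply HX'; exact Hu. }
    apply (Derive3_lincomb o e1 e2 e3 (fun th => r u * cos th) (fun th => r u * sin th)
             (fun _ => h u)); auto_derive; auto; ring. }
  assert (D11 : d1 (d1 X) t theta =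
     lincomb e1 e2 e3 (r2 t * cos theta) (r2 t * sin theta) (h2 t)).
  { unfold d1 at 1.
    etransitivity.
    { apply Derive3_ext_loc, filter_imp with (2 := Hloc t Ht).
      intros v Hv; apply D1; exact Hv. }
    apply (Derive3_lincomb0 e1 e2 e3 (fun u => r1 u * cos theta) (fun u => r1 u * sin theta) h1);
      [| |auto];
      (specialize (Hr1 t Ht); auto_derive; [ex_derive_assumption | Derive_assumption; ring]). }
  assert (D12 : d2 (d1 X) t theta =
     lincomb e1 e2 e3 (- r1 t * sin theta) (r1 t * cos theta) 0).
  { unfold d2.
    etransitivity.
    { apply Derive3_ext_loc, filter_forall; intros v; apply D1; exact Ht. }
    apply (Derive3_lincomb0 e1 e2 e3 (fun th => r1 t * cos th) (fun th => r1 t * sin th)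
             (fun _ => h1 t)); auto_derive; auto; ring. }
  assert (D22 : d2 (d2 X) t theta =
     lincomb e1 e2 e3 (- r t * cos theta) (- r t * sin theta) 0).
  { unfold d2 at 1.
    etransitivity.
    { apply Derive3_ext_loc, filter_forall; intros v; apply D2; exact Ht. }
    apply (Derive3_lincomb0 e1 e2 e3 (fun th => - r t * sin th) (fun th => r t * cos th)
             (fun _ => 0)); auto_derive; auto; ring. }
  specialize (D1 t theta Ht); specialize (D2 t theta Ht).
  pose proof (orthonormal_rotate e1 e2 e3 theta Ho) as Hrot.
  set (f1 := lincomb e1 e2 e3 (cos theta) (sin theta) 0) in Hrot.
  set (f2 := lincomb e1 e2 e3 (- sin theta) (cos theta) 0) in Hrot.
  set (f3 := lincomb e1 e2 e3 0 0 1) in Hrot.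
  assert (Hto : forall x y z u v, u = x * cos theta - y * sin theta ->
     v = x * sin theta + y * cos theta ->
     lincomb e1 e2 e3 u v z = lincomb f1 f2 f3 x y z).
  { intros x y z u v -> ->; apply lincomb_rotate. }
  rewrite (Hto (r1 t) 0 (h1 t)) in D1 by ring.
  rewrite (Hto 0 (r t) 0) in D2 by ring.
  rewrite (Hto (r2 t) 0 (h2 t)) in D11 by ring.
  rewrite (Hto 0 (r1 t) 0) in D12 by ring.
  rewrite (Hto (- r t) 0 0) in D22 by ring.
  intros Him.
  assert (Hne : r t <> 0 /\ r1 t ^ 2 + h1 t ^ 2 <> 0).
  { split; intros H0; apply Him; rewrite D1, D2.
    - rewrite H0; coords; apply f_equal2; [apply f_equal2|]; ring.
    - assert (r1 t = 0 /\ h1 t = 0) as [-> ->] by (split; nra).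
      coords; apply f_equal2; [apply f_equal2|]; ring. }
  destruct Hne as [Hr0 Hv0].
  assert (Hv : 0 < r1 t ^ 2 + h1 t ^ 2)
    by (pose proof (pow2_ge_0 (r1 t)); pose proof (pow2_ge_0 (h1 t)); lra).
  split; [exact Hr0 | split; [exact Hv|]].
  assert (HW : dot (d1 X t theta) (d1 X t theta) * dot (d2 X t theta) (d2 X t theta)
           - dot (d1 X t theta) (d2 X t theta) ^ 2 = r t ^ 2 * (r1 t ^ 2 + h1 t ^ 2)).
  { rewrite D1, D2, !dot_lincomb by exact Hrot; ring. }
  rewrite gauss_curvature_triple; rewrite HW.
  - rewrite D1, D2, D11, D12, D22, !triple_lincomb.
    transitivity (triple f1 f2 f3 ^ 2 *
      (h1 t * (r1 t * h2 t - r2 t * h1 t) / (r t * (r1 t ^ 2 + h1 t ^ 2) ^ 2))).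
    + field; split; [lra | exact Hr0].
    + rewrite (triple_orthonormal _ _ _ Hrot); ring.
  - apply Rmult_lt_0_compat; [|exact Hv].
    pose proof (pow2_ge_0 (r t)); nra.
Qed.

(** * Jacobi elliptic functions *)

(** A derivative bounded below by 1 makes the inverse [g] nonexpansive. The mean
    value theorem writes its difference quotient as [/ f c] with [c] between
    [g s] and [g (s + k)], and then [c] tends to [g s]. *)
Lemma derive_right_inverse (F f g : R -> R) (s : R) :
  (forall x, is_derive F x (f x)) ->
  (forall x, continuous f x) ->
  (forall x, 1 <= f x) ->
  (forall x, F (g x) = x) ->
  is_derive g s (/ f (g s)).
Proof.
  intros HF Hf H1 Hg.
  apply is_derive_Reals; intros e He.
  assert (Hinv : continuity_pt (fun x => / f x) (g s)).
  { apply continuity_pt_inv; [apply continuity_pt_filterlim, Hf|].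
    specialize (H1 (g s)); lra. }
  destruct (Hinv e He) as (d & Hd & Hcont).
  exists (mkposreal d Hd); simpl; intros k Hk0 Hkd.
  destruct (MVT_gen F (g s) (g (s + k)) f) as (c & Hc & Heq).
  { intros x _; apply HF. }
  { intros x _; apply derivable_continuous_pt; exists (f x); apply is_derive_Reals, HF. }
  rewrite !Hg in Heq.
  pose proof (H1 c) as Hfc.
  assert (Hk : g (s + k) - g s = k * / f c).
  { replace k with (f c * (g (s + k) - g s)) at 2 by lra. field; lra. }
  rewrite Hk; replace (k * / f c / k) with (/ f c) by (field; lra).
  destruct (Req_dec c (g s)) as [->|Hne].
  { rewrite Rminus_diag, Rabs_R0; exact He. }
  apply (Hcont c); split.
  { split; [exact I | auto]. }
  (* [c] lies between [g s] and [g (s + k)], whose distance is at most [|k|] *)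
  simpl; unfold Rdist.
  apply Rle_lt_trans with (Rabs (g (s + k) - g s)).
  { unfold Rmin, Rmax in Hc; unfold Rabs;
    repeat destruct Rle_dec; repeat destruct Rcase_abs; lra. }
  rewrite Hk, Rabs_mult, (Rabs_pos_eq (/ f c)) by (apply Rlt_le, Rinv_0_lt_compat; lra).
  apply Rle_lt_trans with (2 := Hkd).
  rewrite <- (Rmult_1_r (Rabs k)) at 2.
  apply Rmult_le_compat_l; [apply Rabs_pos|].
  rewrite <- Rinv_1; apply Rinv_le_contravar; lra.
Qed.

Lemma elliptic_radicand (p v : R) :
  0 < p < 1 -> 0 < 1 - p ^ 2 * sin v ^ 2 <= 1.
Proof.
  intros Hp; pose proof (sin2_cos2 v) as Hsc; unfold Rsqr in Hsc.
  pose proof (pow2_ge_0 (sin v)); pose proof (pow2_ge_0 (cos v)).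
  split; [|nra].
  assert (p ^ 2 < 1) by nra. nra.
Qed.

Lemma continuous_elliptic_integrand (p v : R) :
  continuous (fun v => sqrt (1 - p ^ 2 * sin v ^ 2)) v.
Proof.
  apply (continuous_comp (fun v => 1 - p ^ 2 * sin v ^ 2) sqrt).
  - apply (ex_derive_continuous (fun v => 1 - p ^ 2 * sin v ^ 2)); auto_derive; exact I.
  - apply continuous_sqrt.
Qed.

Lemma elliptic_integrand_pos (p v : R) :
  0 < p < 1 -> 0 < sqrt (1 - p ^ 2 * sin v ^ 2) <= 1.
Proof.
  intros Hp; pose proof (elliptic_radicand p v Hp); split.
  - apply sqrt_lt_R0; lra.
  - rewrite <- sqrt_1 at 2; apply sqrt_le_1_alt; lra.
Qed.

Lemma continuous_elliptic_integrand_inv (p v : R) :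
  0 < p < 1 -> continuous (fun v => / sqrt (1 - p ^ 2 * sin v ^ 2)) v.
Proof.
  intros Hp; apply (continuous_comp (fun v => sqrt (1 - p ^ 2 * sin v ^ 2)) Rinv).
  - apply continuous_elliptic_integrand.
  - apply continuous_Rinv; pose proof (elliptic_integrand_pos p v Hp); lra.
Qed.

Lemma is_derive_RInt_continuous (f : R -> R) (x0 x : R) :
  (forall t, continuous f t) -> is_derive (fun t => RInt f x0 t) x (f x).
Proof.
  intros Hf; apply (is_derive_RInt f (RInt f x0) x0); [|apply Hf].
  apply filter_forall; intros u.
  apply (@RInt_correct R_CompleteNormedModule), (@ex_RInt_continuous R_CompleteNormedModule).
  intros z _; apply Hf.
Qed.

Lemma is_derive_ellint_E (p x : R) :
  is_derive (ellint_E p) x (sqrt (1 - p ^ 2 * sin x ^ 2)).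
Proof.
  apply (is_derive_RInt_continuous (fun v => sqrt (1 - p ^ 2 * sin v ^ 2))).
  apply continuous_elliptic_integrand.
Qed.

Lemma is_derive_ellint_F (p x : R) :
  0 < p < 1 -> is_derive (ellint_F p) x (/ sqrt (1 - p ^ 2 * sin x ^ 2)).
Proof.
  intros Hp; apply (is_derive_RInt_continuous (fun v => / sqrt (1 - p ^ 2 * sin v ^ 2))).
  intros v; apply continuous_elliptic_integrand_inv; exact Hp.
Qed.

Lemma elliptic_integrand_inv_ge_1 (p v : R) :
  0 < p < 1 -> 1 <= / sqrt (1 - p ^ 2 * sin v ^ 2).
Proof.
  intros Hp; pose proof (elliptic_integrand_pos p v Hp).
  rewrite <- Rinv_1 at 1; apply Rinv_le_contravar; lra.
Qed.

(** [ellint_F p x] is at least [x] in absolute value and has the sign of [x], so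
    [ellint_F p] takes every value. *)
Lemma ellint_F_am (p s : R) : 0 < p < 1 -> ellint_F p (am p s) = s.
Proof.
  intros Hp; unfold am; apply epsilon_spec.
  assert (H0 : ellint_F p 0 = 0) by (unfold ellint_F; rewrite RInt_point; reflexivity).
  assert (Hgrow : forall x, exists k, 1 <= k /\ ellint_F p x = k * x).
  { intros x.
    destruct (MVT_itv m_infty p_infty (ellint_F p) _
                (fun t _ => is_derive_ellint_F p t Hp) 0 x)
      as (c & _ & Heq); [split; exact I..|].
    eexists; split; [apply (elliptic_integrand_inv_ge_1 p c Hp)|].
    rewrite H0 in Heq; lra. }
  destruct (Hgrow (Rabs s + 1)) as (k & Hk & Heq).
  destruct (Hgrow (- (Rabs s + 1))) as (k' & Hk' & Heq').
  pose proof (Rabs_pos s); pose proof (Rle_abs s);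
    pose proof (Rle_abs (- s)) as Hneg; rewrite Rabs_Ropp in Hneg.
  destruct (IVT_itv m_infty p_infty (ellint_F p)) with
    (x := - (Rabs s + 1)) (y := Rabs s + 1) (v := s) as (z & _ & Hz);
    try (split; exact I).
  - intros t _; apply (ex_derive_continuous (ellint_F p)).
    eexists; apply is_derive_ellint_F, Hp.
  - rewrite Heq, Heq'; split; nra.
  - exists z; exact Hz.
Qed.

Lemma am_ellint_F (p x : R) : 0 < p < 1 -> am p (ellint_F p x) = x.
Proof.
  intros Hp; set (y := am p (ellint_F p x)).
  assert (Hy : ellint_F p y = ellint_F p x) by (apply ellint_F_am; exact Hp).
  destruct (MVT_itv m_infty p_infty (ellint_F p) _
              (fun t _ => is_derive_ellint_F p t Hp) y x)
    as (c & _ & Heq); [split; exact I..|].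
  pose proof (elliptic_integrand_inv_ge_1 p c Hp). nra.
Qed.

Lemma dn_pos (p s : R) : 0 < p < 1 -> 0 < dn p s.
Proof. intros Hp; apply (elliptic_integrand_pos p (am p s) Hp). Qed.

Lemma dn_sqr (p s : R) : 0 < p < 1 -> dn p s ^ 2 = 1 - p ^ 2 * sn p s ^ 2.
Proof.
  intros Hp; apply pow2_sqrt; pose proof (elliptic_radicand p (am p s) Hp).
  unfold sn; lra.
Qed.

Lemma cn_sqr (p s : R) : cn p s ^ 2 = 1 - sn p s ^ 2.
Proof.
  pose proof (sin2_cos2 (am p s)) as H; unfold Rsqr in H; unfold cn, sn; lra.
Qed.

Lemma is_derive_am (p s : R) : 0 < p < 1 -> is_derive (am p) s (dn p s).
Proof.
  intros Hp.
  replace (dn p s) with (/ (/ sqrt (1 - p ^ 2 * sin (am p s) ^ 2)))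
    by apply Rinv_inv.
  apply (derive_right_inverse (ellint_F p) (fun v => / sqrt (1 - p ^ 2 * sin v ^ 2))).
  - intros x; apply is_derive_ellint_F, Hp.
  - intros x; apply continuous_elliptic_integrand_inv, Hp.
  - intros x; apply elliptic_integrand_inv_ge_1, Hp.
  - intros x; apply ellint_F_am, Hp.
Qed.

Lemma is_derive_sn (p s : R) : 0 < p < 1 -> is_derive (sn p) s (cn p s * dn p s).
Proof.
  intros Hp; pose proof (is_derive_am p s Hp); unfold sn, cn.
  auto_derive; [ex_derive_assumption | Derive_assumption; ring].
Qed.

Lemma is_derive_cn (p s : R) : 0 < p < 1 -> is_derive (cn p) s (- (sn p s * dn p s)).
Proof.
  intros Hp; pose proof (is_derive_am p s Hp); unfold sn, cn.
  auto_derive; [ex_derive_assumption | Derive_assumption; ring].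
Qed.

Lemma is_derive_dn (p s : R) :
  0 < p < 1 -> is_derive (dn p) s (- (p ^ 2 * (sn p s * cn p s))).
Proof.
  intros Hp; pose proof (is_derive_sn p s Hp).
  pose proof (dn_pos p s Hp) as Hpos.
  pose proof (elliptic_radicand p (am p s) Hp) as Hrad; fold (sn p s) in Hrad.
  unfold dn; auto_derive.
  - split; [eexists; eassumption | lra].
  - Derive_assumption.
    replace (1 + - (p * (p * 1) * (sn p s * (sn p s * 1))))
      with (1 - p ^ 2 * sn p s ^ 2) by ring.
    fold (dn p s); field; lra.
Qed.

Lemma is_derive_E_am (p s : R) :
  0 < p < 1 -> is_derive (fun s => ellint_E p (am p s)) s (dn p s ^ 2).
Proof.
  intros Hp.
  replace (dn p s ^ 2) with (scal (dn p s) (dn p s))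
    by (unfold scal; simpl; unfold mult; simpl; ring).
  apply (is_derive_comp (ellint_E p) (am p)).
  - apply is_derive_ellint_E.
  - apply is_derive_am, Hp.
Qed.

(** * The second order equation of the listed profiles *)

(** The common description of the listed profiles, with [z] the derivative of the
    radius [y]. All of them satisfy one second order equation, with first integral
    [z ^ 2 = (C - y ^ 2) * (1 - C + y ^ 2)] where [C] replaces the modulus:
    [C = p ^ 2] in the family of [cn], [C = 1] for the sphere and the
    pseudosphere, [C = / p ^ 2] in the family of [dn]. Only the height equation
    distinguishes the two signs [K0] of the curvature. The last clause says that
    the profile runs through all points of this level curve with [0 < y], which
    supplies the initial value for the comparison with an arbitrary surface. *)
Definition model_profile (C K0 : R) (y h : R -> R) : Prop :=
  exists z : R -> R,
    (forall s, is_derive y s (z s)) /\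
    (forall s, is_derive z s ((2 * C - 1) * y s - 2 * y s ^ 3)) /\
    (forall s, is_derive h s (y s ^ 2 - C + (1 + K0) / 2)) /\
    (forall s, z s ^ 2 = (C - y s ^ 2) * (1 - C + y s ^ 2)) /\
    (forall y0 z0, 0 < y0 -> z0 ^ 2 = (C - y0 ^ 2) * (1 - C + y0 ^ 2) ->
       exists s, y s = y0 /\ z s = z0).

(** The right-hand side is a product of two factors with sum 1, so it is
    nonnegative only if both are. *)
Lemma phase_bound (C y z : R) :
  z ^ 2 = (C - y ^ 2) * (1 - C + y ^ 2) -> C - 1 <= y ^ 2 <= C.
Proof.
  intros H; pose proof (pow2_ge_0 z); split; apply Rnot_lt_le; intros Hlt; nra.
Qed.

Lemma pow2_eq_cases (x y : R) : x ^ 2 = y ^ 2 -> x = y \/ x = - y.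
Proof. intros H; apply Rsqr_eq; unfold Rsqr; lra. Qed.

(** For equal [C] the listed profiles of curvature 1 and -1 have the same radius
    function, and their heights differ by the parameter itself. *)
Lemma model_profile_shift_height (C K0 K1 : R) (y h : R -> R) :
  model_profile C K0 y h ->
  model_profile C K1 y (fun s => h s + (K1 - K0) / 2 * s).
Proof.
  intros (z & Hy & Hz & Hh & Hrest); exists z; split; [exact Hy|split; [exact Hz|split]].
  - intros s; specialize (Hh s).
    auto_derive; [ex_derive_assumption | Derive_assumption; field].
  - exact Hrest.
Qed.

Lemma model_profile_ext (C K0 : R) (y h h' : R -> R) :
  (forall s, h s = h' s) -> model_profile C K0 y h -> model_profile C K0 y h'.
Proof.
  intros Heq (z & Hy & Hz & Hh & Hrest); exists z; split; [exact Hy|split; [exact Hz|split]].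
  - intros s; apply (is_derive_ext h); auto.
  - exact Hrest.
Qed.

(** The amplitudes at which a radius [y0] is attained are those with
    [cos x = y0 / p]. *)
Lemma model_cn (p : R) :
  0 < p < 1 ->
  model_profile (p ^ 2) 1 (fun s => p * cn p s) (fun s => ellint_E p (am p s)).
Proof.
  intros Hp; exists (fun s => - p * (sn p s * dn p s));
    split; [|split; [|split; [|split]]].
  - intros s; pose proof (is_derive_cn p s Hp).
    auto_derive; [ex_derive_assumption | Derive_assumption; ring].
  - intros s; pose proof (is_derive_sn p s Hp); pose proof (is_derive_dn p s Hp).
    auto_derive; [ex_derive_assumption | Derive_assumption].
    transitivity (- p * cn p s * (dn p s ^ 2 - p ^ 2 * sn p s ^ 2)); [ring|].
    transitivity (p * cn p s * (2 * p ^ 2 - 1 - 2 * p ^ 2 * cn p s ^ 2)); [|ring].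
    rewrite (dn_sqr p s Hp), cn_sqr; ring.
  - intros s.
    replace ((p * cn p s) ^ 2 - p ^ 2 + (1 + 1) / 2) with (dn p s ^ 2).
    + apply is_derive_E_am, Hp.
    + rewrite Rpow_mult_distr, (dn_sqr p s Hp), cn_sqr; field.
  - intros s; rewrite !Rpow_mult_distr, (dn_sqr p s Hp), cn_sqr; ring.
  - intros y0 z0 Hy0 Hz0.
    pose proof (phase_bound _ _ _ Hz0) as Hb.
    assert (Hyp : 0 < y0 / p <= 1).
    { split; [apply Rdiv_lt_0_compat; lra|].
      apply Rmult_le_reg_r with p; [lra|].
      replace (y0 / p * p) with y0 by (field; lra). nra. }
    assert (Hs : forall x, cos x = y0 / p ->
      p * cn p (ellint_F p x) = y0 /\
      z0 ^ 2 = (p * (sin x * dn p (ellint_F p x))) ^ 2).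
    { intros x Hx.
      assert (Hc : p * cn p (ellint_F p x) = y0)
        by (unfold cn; rewrite (am_ellint_F p x Hp), Hx; field; lra).
      split; [exact Hc|].
      rewrite Hz0, <- Hc, !Rpow_mult_distr, (dn_sqr p _ Hp), cn_sqr.
      unfold sn; rewrite (am_ellint_F p x Hp); ring. }
    (* the amplitudes [acos (y0 / p)] and [- acos (y0 / p)] give the same radius
       and opposite values of [z] *)
    assert (Hacos : cos (acos (y0 / p)) = y0 / p) by (apply cos_acos; lra).
    destruct (Hs _ Hacos) as [Hc Hz].
    destruct (pow2_eq_cases _ _ Hz) as [Heq|Heq].
    + exists (ellint_F p (- acos (y0 / p))).
      destruct (Hs (- acos (y0 / p))) as [Hc' _]; [rewrite cos_neg; exact Hacos|].
      split; [exact Hc'|]; rewrite Heq.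
      unfold sn, dn, sn; rewrite !(am_ellint_F p _ Hp), sin_neg.
      rewrite <- (Rsqr_pow2 (- _)), <- Rsqr_neg, Rsqr_pow2; ring.
    + exists (ellint_F p (acos (y0 / p))); split; [exact Hc|]; rewrite Heq.
      unfold sn; rewrite !(am_ellint_F p _ Hp); ring.
Qed.

(** A radius [y0] is attained at the amplitudes with
    [(sin x) ^ 2 = / p ^ 2 - y0 ^ 2]. *)
Lemma model_dn (p : R) :
  0 < p < 1 ->
  model_profile (/ p ^ 2) 1 (fun s => 1 / p * dn p (s / p))
    (fun s => 1 / p * ellint_E p (am p (s / p)) - (1 - p ^ 2) / p ^ 2 * s).
Proof.
  intros Hp; exists (fun s => - (sn p (s / p) * cn p (s / p)));
    split; [|split; [|split; [|split]]].
  - intros s; pose proof (is_derive_dn p (s / p) Hp).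
    auto_derive; [ex_derive_assumption | Derive_assumption; field; lra].
  - intros s; pose proof (is_derive_sn p (s / p) Hp); pose proof (is_derive_cn p (s / p) Hp).
    auto_derive; [ex_derive_assumption | Derive_assumption].
    change (s * / p) with (s / p).
    transitivity (/ p * dn p (s / p) * (sn p (s / p) ^ 2 - cn p (s / p) ^ 2)); [field; lra|].
    transitivity (/ p * dn p (s / p) * (2 / p ^ 2 - 1 - 2 / p ^ 2 * dn p (s / p) ^ 2));
      [|field; lra].
    rewrite (dn_sqr p _ Hp), cn_sqr; field; lra.
  - intros s; pose proof (is_derive_E_am p (s / p) Hp).
    assert (Hd : is_derive (fun s => ellint_E p (am p (s / p))) s (/ p * dn p (s / p) ^ 2)).
    { apply (is_derive_comp (fun u => ellint_E p (am p u)) (fun s => s / p)); [assumption|].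
      auto_derive; [exact I | field; lra]. }
    set (g := fun s => ellint_E p (am p (s / p))).
    change (is_derive g s (/ p * dn p (s / p) ^ 2)) in Hd.
    change (is_derive (fun s => 1 / p * g s - (1 - p ^ 2) / p ^ 2 * s) s
              ((1 / p * dn p (s / p)) ^ 2 - / p ^ 2 + (1 + 1) / 2)).
    clearbody g; auto_derive; [ex_derive_assumption | Derive_assumption].
    rewrite Rpow_mult_distr; field; lra.
  - intros s.
    transitivity (sn p (s / p) ^ 2 * cn p (s / p) ^ 2); [ring|].
    rewrite Rpow_mult_distr, (dn_sqr p _ Hp), cn_sqr; field; lra.
  - intros y0 z0 Hy0 Hz0.
    pose proof (phase_bound _ _ _ Hz0) as Hb.
    set (m := sqrt (/ p ^ 2 - y0 ^ 2)).
    assert (Hm0 : 0 <= m) by apply sqrt_pos.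
    assert (Hm2 : m ^ 2 = / p ^ 2 - y0 ^ 2) by (apply pow2_sqrt; lra).
    assert (Hm1 : m <= 1) by nra.
    assert (Hs : forall x, sin x ^ 2 = m ^ 2 ->
      1 / p * dn p (p * ellint_F p x / p) = y0 /\
      z0 ^ 2 = (sin x * cos x) ^ 2).
    { intros x Hx.
      replace (p * ellint_F p x / p) with (ellint_F p x) by (field; lra).
      unfold dn, sn; rewrite (am_ellint_F p x Hp), Hx, Hm2.
      pose proof (sin2_cos2 x) as Hsc; unfold Rsqr in Hsc.
      replace (1 - p ^ 2 * (/ p ^ 2 - y0 ^ 2)) with ((p * y0) ^ 2) by (field; lra).
      rewrite sqrt_pow2 by nra.
      split; [field; lra|].
      rewrite Hz0, Rpow_mult_distr, Hx, <- Hm2.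
      replace (cos x ^ 2) with (1 - sin x ^ 2) by lra.
      rewrite Hx, Hm2; ring. }
    (* the amplitudes [asin m] and [- asin m] give the same radius and opposite
       values of [z] *)
    assert (Hasin : sin (asin m) = m) by (apply sin_asin; lra).
    destruct (Hs (asin m)) as [Hc Hz]; [rewrite Hasin; reflexivity|].
    destruct (pow2_eq_cases _ _ Hz) as [Heq|Heq].
    + exists (p * ellint_F p (- asin m)).
      destruct (Hs (- asin m)) as [Hc' _]; [rewrite sin_neg, Hasin; ring|].
      split; [exact Hc'|]; rewrite Heq.
      replace (p * ellint_F p (- asin m) / p) with (ellint_F p (- asin m)) by (field; lra).
      unfold sn, cn; rewrite !(am_ellint_F p _ Hp), sin_neg, cos_neg; ring.
    + exists (p * ellint_F p (asin m)); split; [exact Hc|]; rewrite Heq.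
      replace (p * ellint_F p (asin m) / p) with (ellint_F p (asin m)) by (field; lra).
      unfold sn, cn; rewrite !(am_ellint_F p _ Hp); ring.
Qed.

Lemma cosh_sqr (s : R) : cosh s ^ 2 = 1 + sinh s ^ 2.
Proof.
  unfold cosh, sinh.
  assert (H : exp s * exp (- s) = 1) by (rewrite <- exp_plus, Rplus_opp_r; apply exp_0).
  nra.
Qed.

Lemma cosh_pos (s : R) : 0 < cosh s.
Proof. unfold cosh; pose proof (exp_pos s); pose proof (exp_pos (- s)); lra. Qed.

Lemma model_sech : model_profile 1 1 (fun s => 1 / cosh s) (fun s => tanh s).
Proof.
  exists (fun s => - sinh s / cosh s ^ 2);
    split; [|split; [|split; [|split]]].
  - intros s; pose proof (cosh_pos s).
    auto_derive; [lra | field; lra].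
  - intros s; pose proof (cosh_pos s).
    auto_derive; [apply Rgt_not_eq; nra|].
    transitivity ((2 * sinh s ^ 2 - cosh s ^ 2) / cosh s ^ 3); [field; lra|].
    replace (sinh s ^ 2) with (cosh s ^ 2 - 1) by (rewrite cosh_sqr; ring).
    field; lra.
  - intros s; pose proof (cosh_pos s).
    unfold tanh; auto_derive; [lra|].
    transitivity ((cosh s ^ 2 - sinh s ^ 2) / cosh s ^ 2); [field; lra|].
    replace (sinh s ^ 2) with (cosh s ^ 2 - 1) by (rewrite cosh_sqr; ring).
    field; lra.
  - intros s; pose proof (cosh_pos s).
    transitivity (sinh s ^ 2 / cosh s ^ 4); [field; lra|].
    replace (sinh s ^ 2) with (cosh s ^ 2 - 1) by (rewrite cosh_sqr; ring).
    field; lra.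
  - intros y0 z0 Hy0 Hz0.
    (* the value [- z0 / y0 ^ 2] is forced by [z = - sinh * y ^ 2] *)
    exists (arcsinh (- z0 / y0 ^ 2)).
    set (s := arcsinh _).
    assert (Hs : sinh s = - z0 / y0 ^ 2) by apply sinh_arcsinh.
    assert (Hc : cosh s = / y0).
    { apply Rsqr_inj; [apply Rlt_le, cosh_pos | apply Rlt_le, Rinv_0_lt_compat; lra|].
      rewrite !Rsqr_pow2, cosh_sqr, Hs.
      replace ((- z0 / y0 ^ 2) ^ 2) with (z0 ^ 2 / y0 ^ 4) by (field; lra).
      rewrite Hz0; field; lra. }
    rewrite Hs, Hc; split; field; lra.
Qed.

Lemma listed_profile_exists (C K0 : R) :
  0 < C -> K0 = 1 \/ K0 = -1 ->
  exists y h, listed_profile K0 y h /\ model_profile C K0 y h.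
Proof.
  intros HC HK0.
  destruct (Rtotal_order C 1) as [Hlt|[->|Hgt]].
  - set (p := sqrt C).
    assert (Hp : 0 < p < 1).
    { split; [apply sqrt_lt_R0; lra|].
      rewrite <- sqrt_1; apply sqrt_lt_1_alt; lra. }
    replace C with (p ^ 2) by (apply pow2_sqrt; lra).
    pose proof (model_cn p Hp) as Hmod.
    destruct HK0 as [-> | ->].
    + do 2 eexists; split; [exact (listed_cn_pos p Hp) | exact Hmod].
    + do 2 eexists; split; [exact (listed_cn_neg p Hp)|].
      refine (model_profile_ext _ _ _ _ _ _ (model_profile_shift_height _ _ (-1) _ _ Hmod)).
      intros s; simpl; field.
  - destruct HK0 as [-> | ->].
    + do 2 eexists; split; [exact listed_sphere | exact model_sech].
    + do 2 eexists; split; [exact listed_pseudosphere|].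
      refine (model_profile_ext _ _ _ _ _ _
                (model_profile_shift_height _ _ (-1) _ _ model_sech)).
      intros s; simpl; field.
  - set (p := / sqrt C).
    assert (Hsqrt : 1 < sqrt C) by (rewrite <- sqrt_1; apply sqrt_lt_1_alt; lra).
    assert (Hp : 0 < p < 1).
    { split; [apply Rinv_0_lt_compat; lra|].
      rewrite <- Rinv_1; apply Rinv_lt_contravar; lra. }
    replace C with (/ p ^ 2)
      by (unfold p; rewrite pow_inv, Rinv_inv; apply pow2_sqrt; lra).
    pose proof (model_dn p Hp) as Hmod.
    destruct HK0 as [-> | ->].
    + do 2 eexists; split; [exact (listed_dn_pos p Hp) | exact Hmod].
    + do 2 eexists; split; [exact (listed_dn_neg p Hp)|].
      refine (model_profile_ext _ _ _ _ _ _ (model_profile_shift_height _ _ (-1) _ _ Hmod)).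
      intros s; simpl; field; lra.
Qed.

(** * From constant curvature to the phase system *)

(** The squared speed of the profile is [z ^ 2 + h1 ^ 2 = K0 * h1], where [h1] is the
    derivative of the height; this turns the curvature formula into a rational
    identity in [h1] alone. *)
Lemma model_curvature (C K0 : R) (y h : R -> R) (s theta : R) :
  K0 = 1 \/ K0 = -1 ->
  model_profile C K0 y h ->
  immersed_at (revolve y h) s theta ->
  gauss_curvature (revolve y h) s theta = K0.
Proof.
  intros HK0 (z & Hy & Hz & Hh & Hphase & _) Him.
  set (h1 := fun s => y s ^ 2 - C + (1 + K0) / 2).
  assert (Hh1 : forall s, is_derive h1 s (2 * y s * z s)).
  { intros u; unfold h1; specialize (Hy u).
    auto_derive; [ex_derive_assumption | Derive_assumption; ring]. }
  destruct (revolution_geometry m_infty p_infty (revolve y h)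
              (0, 0, 0) (1, 0, 0) (0, 1, 0) (0, 0, 1)
              y h z h1 (fun s => (2 * C - 1) * y s - 2 * y s ^ 3)
              (fun s => 2 * y s * z s) s theta) as (Hy0 & Hv & ->); auto.
  - repeat split; coords; ring.
  - intros t th _; rewrite plus_scal_lincomb; unfold revolve; coords.
    apply f_equal2; [apply f_equal2|]; ring.
  - split; exact I.
  - specialize (Hphase s).
    assert (HV : z s ^ 2 + h1 s ^ 2 = K0 * h1 s).
    { rewrite Hphase; unfold h1; destruct HK0 as [-> | ->]; field. }
    rewrite HV in Hv |- *.
    assert (Hne : h1 s <> 0) by (intros H0; rewrite H0 in Hv; lra).
    transitivity ((2 * z s ^ 2 - ((2 * C - 1) - 2 * y s ^ 2) * h1 s) / (K0 ^ 2 * h1 s)).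
    + field; repeat split; auto; destruct HK0; lra.
    + assert (Hy2 : y s ^ 2 = h1 s + C - (1 + K0) / 2) by (unfold h1; ring).
      rewrite Hphase, Hy2; revert Hne; generalize (h1 s); intros H Hne.
      destruct HK0 as [-> | ->]; field; exact Hne.
Qed.

(** The sign [sigma = -1] reverses the axis; the sign [tau = -1] is the half turn
    about it, needed when the profile lies on the side of negative radius. *)
Lemma similarity_of_frame (o e1 e2 e3 : R3) (k m sigma tau : R) :
  orthonormal e1 e2 e3 -> 0 < k -> sigma ^ 2 = 1 -> tau ^ 2 = 1 ->
  similarity (fun u =>
    plus o (plus (scal (k * tau * crd1 u) e1)
           (plus (scal (k * tau * crd2 u) e2)
                 (scal (k * sigma * (crd3 u + m)) e3)))).
Proof.
  intros Ho Hk Hs Ht; set (f := fun u : R3 => _).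
  exists k, (fun u => scal (/ k) (f u)); split; [exact Hk | split].
  - intros u v; unfold enorm; apply f_equal.
    transitivity (dot
      (lincomb e1 e2 e3 (tau * (crd1 u - crd1 v)) (tau * (crd2 u - crd2 v))
                        (sigma * (crd3 u - crd3 v)))
      (lincomb e1 e2 e3 (tau * (crd1 u - crd1 v)) (tau * (crd2 u - crd2 v))
                        (sigma * (crd3 u - crd3 v)))).
    + apply (f_equal (fun w => dot w w)).
      unfold f; rewrite !plus_scal_lincomb, minus_coords, !scal_coords; coords.
      apply f_equal2; [apply f_equal2|]; field; lra.
    + rewrite dot_lincomb by exact Ho.
      rewrite minus_coords; unfold dot; simpl.
      transitivity (tau ^ 2 * ((crd1 u - crd1 v) ^ 2 + (crd2 u - crd2 v) ^ 2)
                    + sigma ^ 2 * (crd3 u - crd3 v) ^ 2); [ring|].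
      rewrite Hs, Ht; coords; ring.
  - intros u; generalize (f u); intros w; rewrite !scal_coords; coords.
    destruct w as [[w1 w2] w3]; simpl.
    apply f_equal2; [apply f_equal2|]; field; lra.
Qed.

(** The equations of [model_profile] for a curve in a parameter [t] with
    [ds = p dt], so that no inverse of the change of parameter is needed. *)
Definition phase_system (a b : Rbar) (C K0 : R) (p rho zeta eta : R -> R) : Prop :=
  forall t, in_itv a b t ->
    is_derive rho t (p t * zeta t) /\
    is_derive zeta t (p t * ((2 * C - 1) * rho t - 2 * rho t ^ 3)) /\
    is_derive eta t (p t * (rho t ^ 2 - C + (1 + K0) / 2)) /\
    zeta t ^ 2 = (C - rho t ^ 2) * (1 - C + rho t ^ 2).

(** With [V] the squared speed, [H = h1 ^ 2 / V] is the squared sine of the angle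
    between the profile and the direction orthogonal to the axis. The curvature
    equation says that [lambda ^ 2 * r ^ 2 - K0 * H] is constant; [C] is this
    constant normalized by [(1 + K0) / 2]. The parameter with
    [ds = lambda * |V / h1| dt] is the one in which the height of the scaled
    profile has derivative of absolute value [H]. Since [0 < H <= 1] and
    [r] has no zero, [C] is positive for both signs of the curvature. *)
Lemma phase_system_of_curvature (a b : Rbar) (r h r1 h1 r2 h2 : R -> R)
    (lambda K0 tau delta t0 : R) :
  in_itv a b t0 ->
  0 < lambda -> K0 = 1 \/ K0 = -1 -> tau ^ 2 = 1 -> delta ^ 2 = 1 ->
  (forall t, in_itv a b t -> is_derive r t (r1 t)) ->
  (forall t, in_itv a b t -> is_derive h t (h1 t)) ->
  (forall t, in_itv a b t -> is_derive r1 t (r2 t)) ->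
  (forall t, in_itv a b t -> is_derive h1 t (h2 t)) ->
  (forall t, in_itv a b t -> r t <> 0) ->
  (forall t, in_itv a b t -> h1 t <> 0) ->
  (forall t, in_itv a b t ->
     K0 * lambda ^ 2 = h1 t * (r1 t * h2 t - r2 t * h1 t)
                       / (r t * (r1 t ^ 2 + h1 t ^ 2) ^ 2)) ->
  exists C, 0 < C /\
    phase_system a b C K0
      (fun t => lambda * delta * ((r1 t ^ 2 + h1 t ^ 2) / h1 t))
      (fun t => tau * lambda * r t)
      (fun t => tau * delta * (r1 t * h1 t / (r1 t ^ 2 + h1 t ^ 2)))
      (fun t => K0 * delta * lambda * h t).
Proof.
  intros Ht0 Hl HK0 Htau Hdelta Hr Hh Hr1 Hh1 Hrn Hhn Hcurv.
  assert (HK2 : K0 ^ 2 = 1) by (destruct HK0 as [-> | ->]; ring).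
  set (V := fun t => r1 t ^ 2 + h1 t ^ 2).
  assert (HV : forall t, in_itv a b t -> 0 < V t).
  { intros t Ht; unfold V; pose proof (pow2_ge_0 (r1 t)).
    pose proof (pow2_gt_0 _ (Hhn t Ht)); lra. }
  (* the curvature equation solved for the Wronskian, which is the only way the
     second derivatives enter below *)
  assert (HJ : forall t, in_itv a b t ->
    r1 t * h2 t - r2 t * h1 t = K0 * lambda ^ 2 * r t * V t ^ 2 / h1 t).
  { intros t Ht; pose proof (HV t Ht); pose proof (Hrn t Ht); pose proof (Hhn t Ht).
    rewrite (Hcurv t Ht); fold (V t); field; repeat split; auto; lra. }
  set (c := fun t => lambda ^ 2 * r t ^ 2 + (1 + K0) / 2 - K0 * (h1 t ^ 2 / V t)).
  assert (Hc : forall t, in_itv a b t -> is_derive c t 0).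
  { intros t Ht; pose proof (HV t Ht) as HVt; unfold c; unfold V in HVt |- *.
    pose proof (Hr t Ht); pose proof (Hr1 t Ht); pose proof (Hh1 t Ht).
    auto_derive; [repeat split; try (eexists; eassumption); simpl in HVt; lra|].
    Derive_assumption.
    transitivity (2 * lambda ^ 2 * r t * r1 t
      - 2 * K0 * h1 t * r1 t * (r1 t * h2 t - r2 t * h1 t) / V t ^ 2).
    { unfold V; field; lra. }
    rewrite (HJ t Ht); fold (V t) in HVt.
    transitivity (2 * lambda ^ 2 * r t * r1 t * (1 - K0 ^ 2));
      [field; split; [apply Hhn, Ht | lra] | rewrite HK2; ring]. }
  exists (c t0); split.
  - pose proof (HV t0 Ht0) as HVt.
    assert (0 < lambda ^ 2 * r t0 ^ 2)
      by (apply Rmult_lt_0_compat; apply pow2_gt_0; [lra | apply Hrn, Ht0]).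
    assert (0 < h1 t0 ^ 2 / V t0) by (apply Rdiv_lt_0_compat; [apply pow2_gt_0, Hhn, Ht0 | lra]).
    assert (1 - h1 t0 ^ 2 / V t0 = r1 t0 ^ 2 / V t0) by (unfold V in *; field; lra).
    assert (0 <= r1 t0 ^ 2 / V t0) by (apply Rdiv_le_0_compat; [apply pow2_ge_0 | lra]).
    unfold c; destruct HK0 as [-> | ->]; lra.
  - intros t Ht.
    rewrite <- (constant_of_derive_zero a b c Hc t0 t Ht0 Ht).
    pose proof (HV t Ht) as HVt; pose proof (Hhn t Ht) as Hht.
    pose proof (Hr t Ht); pose proof (Hr1 t Ht); pose proof (Hh1 t Ht); pose proof (Hh t Ht).
    fold (V t).
    assert (Hrho : (tau * lambda * r t) ^ 2 = lambda ^ 2 * r t ^ 2)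
      by (rewrite !Rpow_mult_distr, Htau; ring).
    assert (Hgap : c t - (tau * lambda * r t) ^ 2 = (1 + K0) / 2 - K0 * (h1 t ^ 2 / V t))
      by (rewrite Hrho; unfold c; ring).
    split; [|split; [|split]].
    + auto_derive; [ex_derive_assumption | Derive_assumption].
      transitivity (tau * lambda * r1 t * delta ^ 2);
        [rewrite Hdelta; ring | field; lra].
    + replace ((2 * c t - 1) * (tau * lambda * r t) - 2 * (tau * lambda * r t) ^ 3)
        with ((2 * (c t - (tau * lambda * r t) ^ 2) - 1) * (tau * lambda * r t)) by ring.
      rewrite Hgap; unfold V in HVt.
      auto_derive; [repeat split; try (eexists; eassumption); simpl in HVt; lra|].
      Derive_assumption.
      transitivity (tau * delta * (r1 t ^ 2 - h1 t ^ 2)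
                    * (r1 t * h2 t - r2 t * h1 t) / V t ^ 2).
      { unfold V; field; lra. }
      rewrite (HJ t Ht); unfold V; field; split; lra.
    + replace ((tau * lambda * r t) ^ 2 - c t + (1 + K0) / 2)
        with (K0 * (h1 t ^ 2 / V t)) by lra.
      auto_derive; [ex_derive_assumption | Derive_assumption; field; lra].
    + rewrite Hgap.
      replace (1 - c t + (tau * lambda * r t) ^ 2)
        with (1 - ((1 + K0) / 2 - K0 * (h1 t ^ 2 / V t))) by lra.
      rewrite !Rpow_mult_distr, Htau, Hdelta.
      unfold V in HVt |- *.
      destruct HK0 as [-> | ->]; field; lra.
Qed.

(** After the initial values are matched, the differences of radii and of their
    derivatives solve a linear system whose coefficient [q] is bounded, because
    both radii satisfy [y ^ 2 <= C]. So the radii agree, and then the heights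
    have equal derivatives. *)
Lemma phase_system_follows_model (a b : Rbar) (C K0 : R)
    (p rho zeta eta y h : R -> R) (t0 : R) :
  in_itv a b t0 ->
  (forall t, in_itv a b t -> 0 < p t) ->
  (forall t, in_itv a b t -> continuous p t) ->
  phase_system a b C K0 p rho zeta eta ->
  0 < rho t0 ->
  model_profile C K0 y h ->
  exists phi m,
    (forall t, in_itv a b t -> is_derive phi t (p t)) /\
    (forall t, in_itv a b t -> rho t = y (phi t)) /\
    (forall t, in_itv a b t -> eta t = h (phi t) + m).
Proof.
  intros Ht0 Hp Hpc Hsys Hpos (z & Hy & Hz & Hh & Hphase & Hreach).
  destruct (Hreach (rho t0) (zeta t0) Hpos) as (s0 & Hy0 & Hz0); [apply Hsys, Ht0|].
  destruct (primitive_itv a b p t0 s0 Ht0 Hpc) as (phi & Hphi0 & Hphi).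
  assert (Hcomp : forall f df, (forall s, is_derive f s (df s)) ->
    forall t, in_itv a b t -> is_derive (fun t => f (phi t)) t (p t * df (phi t))).
  { intros f df Hf t Ht; apply (is_derive_comp f phi); auto. }
  assert (Hrho : forall t, in_itv a b t -> rho t = y (phi t)).
  { (* the difference quotient of [(2 * C - 1) * x - 2 * x ^ 3] between the radii *)
    set (q := fun t => 2 * C - 1 - 2 * (rho t ^ 2 + rho t * y (phi t) + y (phi t) ^ 2)).
    intros t Ht; apply Rminus_diag_uniq.
    apply (linear_system_zero a b (fun t => rho t - y (phi t)) (fun t => zeta t - z (phi t))
             phi p q (8 * C + 1) t0); auto.
    - rewrite Hphi0, Hy0; ring.
    - rewrite Hphi0, Hz0; ring.
    - intros u Hu; destruct (Hsys u Hu) as (H & _).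
      replace (p u * (zeta u - z (phi u))) with (p u * zeta u - p u * z (phi u)) by ring.
      apply (is_derive_minus rho (fun t => y (phi t))); auto.
    - intros u Hu; destruct (Hsys u Hu) as (_ & H & _).
      replace (p u * (q u * (rho u - y (phi u)))) with
        (p u * ((2 * C - 1) * rho u - 2 * rho u ^ 3)
         - p u * ((2 * C - 1) * y (phi u) - 2 * y (phi u) ^ 3)) by (unfold q; ring).
      apply (is_derive_minus zeta (fun t => z (phi t))); [exact H|].
      apply (Hcomp z (fun s => (2 * C - 1) * y s - 2 * y s ^ 3)); auto.
    - intros u Hu; destruct (Hsys u Hu) as (_ & _ & _ & H).
      pose proof (phase_bound _ _ _ H); pose proof (phase_bound _ _ _ (Hphase (phi u))).
      pose proof (pow2_ge_0 (rho u)); pose proof (pow2_ge_0 (y (phi u))).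
      pose proof (pow2_ge_0 (rho u + y (phi u))); pose proof (pow2_ge_0 (rho u - y (phi u))).
      unfold q; apply Rabs_le; split; nra. }
  exists phi, (eta t0 - h (phi t0)); split; [exact Hphi | split; [exact Hrho|]].
  intros t Ht.
  enough (eta t - h (phi t) = eta t0 - h (phi t0)) by lra.
  apply (constant_of_derive_zero a b (fun t => eta t - h (phi t))); auto.
  intros u Hu; destruct (Hsys u Hu) as (_ & _ & H & _).
  replace 0 with (p u * (rho u ^ 2 - C + (1 + K0) / 2)
                  - p u * (y (phi u) ^ 2 - C + (1 + K0) / 2))
    by (rewrite (Hrho u Hu); ring).
  apply (is_derive_minus eta (fun t => h (phi t))); [exact H|].
  apply (Hcomp h (fun s => y s ^ 2 - C + (1 + K0) / 2)); auto.
Qed.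

Lemma nonzero_split (K : R) :
  K <> 0 -> exists K0 lambda, (K0 = 1 \/ K0 = -1) /\ 0 < lambda /\ K = K0 * lambda ^ 2.
Proof.
  intros HK.
  destruct (Rtotal_order K 0) as [H|[H|H]]; [|lra|].
  - exists (-1), (sqrt (- K)); rewrite pow2_sqrt by lra.
    split; [auto | split; [apply sqrt_lt_R0; lra | ring]].
  - exists 1, (sqrt K); rewrite pow2_sqrt by lra.
    split; [auto | split; [apply sqrt_lt_R0; lra | ring]].
Qed.

Theorem theorem3p1 (a b : Rbar) (X : R -> R -> R3) (K : R)
    (hX : surface_of_revolution a b X)
    (hK : K <> 0)
    (hcurv : forall t theta, in_itv a b t -> gauss_curvature X t theta = K) :
  exists (K0 : R) (r h : R -> R),
    listed_profile K0 r h /\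
    (forall s theta, immersed_at (revolve r h) s theta ->
       gauss_curvature (revolve r h) s theta = K0) /\
    homothetic_to_part_of a b X (revolve r h).
Proof.
  destruct hX as (Hab & (o & e1 & e2 & e3 & r & h & Ho & Hr & Hh & _ & HX) & Him).
  destruct (in_itv_inhabited a b Hab) as [t0 Ht0].
  pose proof (smooth_on_Derive a b r Hr) as Hr'.
  pose proof (smooth_on_Derive a b h Hh) as Hh'.
  assert (Hd : forall f t, smooth_on a b f -> in_itv a b t -> is_derive f t (Derive f t))
    by (intros; eapply smooth_on_is_derive; eauto).
  set (V := fun t => Derive r t ^ 2 + Derive h t ^ 2).
  assert (Hgeom : forall t, in_itv a b t ->
    r t <> 0 /\ 0 < V t /\
    K = Derive h t * (Derive r t * Derive (Derive h) t - Derive (Derive r) t * Derive h t)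
        / (r t * V t ^ 2)).
  { intros t Ht; rewrite <- (hcurv t 0 Ht).
    apply (revolution_geometry a b X o e1 e2 e3 r h); auto. }
  assert (Hh'0 : forall t, in_itv a b t -> Derive h t <> 0).
  { intros t Ht H0; destruct (Hgeom t Ht) as (_ & _ & HKt).
    apply hK; rewrite HKt, H0; unfold Rdiv; ring. }
  assert (Hcont : forall f, smooth_on a b f -> forall t, in_itv a b t -> continuous f t).
  { intros f Hf t Ht; apply (ex_derive_continuous f); exact (Hf 1%nat t Ht). }
  destruct (constant_sign a b r Hab) as (tau & Htau & Hrpos); auto.
  { intros t Ht; apply Hgeom, Ht. }
  destruct (constant_sign a b (Derive h) Hab) as (delta & Hdelta & Hhpos); auto.
  destruct (nonzero_split K hK) as (K0 & lambda & HK0 & Hl & HK).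
  set (p := fun t => lambda * delta * (V t / Derive h t)).
  destruct (phase_system_of_curvature a b r h (Derive r) (Derive h)
              (Derive (Derive r)) (Derive (Derive h)) lambda K0 tau delta t0)
    as (C & HC & Hsys); auto.
  { intros t Ht; apply Hgeom, Ht. }
  { intros t Ht; rewrite <- HK; apply Hgeom, Ht. }
  assert (Hp : forall t, in_itv a b t -> 0 < p t).
  { intros t Ht; destruct (Hgeom t Ht) as (_ & HV & _).
    specialize (Hhpos t Ht); specialize (Hh'0 t Ht).
    replace (p t) with (lambda * (V t / (delta * Derive h t))).
    - apply Rmult_lt_0_compat; [exact Hl | apply Rdiv_lt_0_compat; assumption].
    - unfold p; assert (delta <> 0) by (intros H0; rewrite H0 in Hhpos; lra).
      replace (lambda * delta) with (lambda * delta ^ 2 / delta) by (field; assumption).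
      rewrite Hdelta; field; split; assumption. }
  assert (Hps : smooth_on a b p).
  { revert Hr' Hh'; rewrite !smooth_on_differentiable_on; intros Hr' Hh' n.
    unfold p, V, Rdiv; simpl.
    repeat first [ apply differentiable_on_mult | apply differentiable_on_plus
                 | apply differentiable_on_inv | apply differentiable_on_const
                 | assumption | apply Hr' | apply Hh' ]. }
  destruct (listed_profile_exists C K0 HC HK0) as (y & g & Hlist & Hmod).
  destruct (phase_system_follows_model a b C K0 p _ _ _ y g t0 Ht0 Hp
              (Hcont p Hps) Hsys) as (phi & m & Hphi & Hrho & Heta); auto.
  { replace (tau * lambda * r t0) with (lambda * (tau * r t0)) by ring.
    apply Rmult_lt_0_compat; auto. }
  exists K0, y, g; split; [exact Hlist | split].
  { intros s theta; apply (model_curvature C); assumption. }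
  destruct (reparametrization_onto_image a b phi p Hphi Hp Hps) as (c & d & Hrep).
  exists c, d, phi,
    (fun u => plus o (plus (scal (/ lambda * tau * crd1 u) e1)
                     (plus (scal (/ lambda * tau * crd2 u) e2)
                           (scal (/ lambda * (K0 * delta) * (crd3 u + m)) e3)))).
  split; [exact Hrep | split].
  - apply similarity_of_frame; auto.
    + apply Rinv_0_lt_compat, Hl.
    + rewrite Rpow_mult_distr, Hdelta; destruct HK0 as [-> | ->]; ring.
  - intros t theta Ht; rewrite (HX t theta Ht).
    assert (Hrt : r t = / lambda * tau * y (phi t)).
    { rewrite <- (Hrho t Ht).
      transitivity (tau ^ 2 * r t); [rewrite Htau; ring | field; lra]. }
    assert (Hht : h t = / lambda * (K0 * delta) * (g (phi t) + m)).
    { rewrite <- (Heta t Ht).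
      transitivity (K0 ^ 2 * delta ^ 2 * h t); [|field; lra].
      rewrite Hdelta; destruct HK0 as [-> | ->]; ring. }
    rewrite Hrt, Hht; unfold revolve, crd1, crd2, crd3; simpl.
    rewrite !Rmult_assoc; reflexivity.
Qed.
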